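(* Let $(Z,r)$ be a strong twisted union of the 2-cancellative disjoint solutions $(X,r_X)$ and $(Y,r_Y)$ of the Yang-Baxter equation. Suppose $\mathbf{lri}$ holds for $(Z,r)$ and $U=S(Z,r)$ has cancellation on monomials of length $3$. Then $(Z,r)$ obeys the Yang-Baxter equation if and only if $$\mathbf{csla}:\ {}^{{}^y\alpha}({}^yx)={}^{{}^{\alpha}y}({}^{\alpha}x),\qquad \mathbf{csra}:\ (\alpha^{\beta})^{x^{\beta}}=(\alpha^x)^{\beta^x}$$ for all $x,y\in X$, $\alpha,\beta\in Y$.
   Context: A quadratic set $(X,r)$ is a nonempty set with a bijection $r:X\times X\to X\times X$, written $r(x,y)=({}^xy,x^y)$; it is a solution if $r^{12}r^{23}r^{12}=r^{23}r^{12}r^{23}$ on $X^3$ (Yang-Baxter equation). It is 2-cancellative if for every positive integer $k$ less than the order of $r$ (possibly infinite): $r^k(x,y)=(x,z)$ implies $z=y$, and $r^k(x,y)=(t,y)$ implies $x=t$. Condition $\mathbf{lri}$ for $(Z,r)$: $({}^zw)^z=w={}^z(w^z)$ for all $z,w\in Z$. The associated monoid $S(X,r)$ (group $G(X,r)$) is generated by $X$ with defining relations $xy=zt$ whenever $r(x,y)=(z,t)$; the monoid is graded by length. It has cancellation on monomials of length $3$ if for all its elements $a,b,c$ with $|a|+|b|=|a|+|c|=3$, each of $ab=ac$ and $ba=ca$ implies $b=c$. A regular extension of disjoint quadratic sets $(X,r_X),(Y,r_Y)$ is $Z=X\sqcup Y$ with a bijection $r:Z\times Z\to Z\times Z$,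 $r(z,w)=({}^zw,z^w)$, such that $r|_{X\times X}=r_X$, $r|_{Y\times Y}=r_Y$, $r$ restricts to a bijection $Y\times X\to X\times Y$, $r(\alpha,x)=({}^\alpha x,\alpha^x)$ (ground actions), and $r|_{X\times Y}=(r|_{Y\times X})^{-1}:X\times Y\to Y\times X$, $r(x,\alpha)=({}^x\alpha,x^\alpha)$. A regular extension $(Z,r)$ is a strong twisted union of $(X,r_X)$ and $(Y,r_Y)$ if (1) $\alpha\mapsto{}^\alpha\bullet$ extends to a left action of the group $G(Y,r_Y)$ (and of the monoid $S(Y,r_Y)$) on $X$, and $x\mapsto\bullet^x$ extends to a right action of the group $G(X,r_X)$ (and of the monoid $S(X,r_X)$) on $Y$; (2) ${}^{\alpha^y}x={}^\alpha x$ and $\alpha^{{}^\beta x}=\alpha^x$ for all $x,y\in X$, $\alpha,\beta\in Y$. *)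

(* Defs.v *)
From HB Require Import structures.
From mathcomp Require Import all_boot generic_quotient.
From mathcomp Require Import boolp.

Set Implicit Arguments.
Unset Strict Implicit.
Unset Printing Implicit Defensive.

Local Open Scope quotient_scope.
Local Open Scope group_scope.

(* Monoids presented by generators [A] and relations [R]: words over [A]
   modulo the least congruence for concatenation containing [R]. *)

Inductive word_cong (A : Type) (R : seq A -> seq A -> Prop) :
    seq A -> seq A -> Prop :=
  | WCrel u v s t : R s t -> word_cong R (u ++ s ++ v) (u ++ t ++ v)
  | WCrefl s : word_cong R s s
  | WCsym s t : word_cong R s t -> word_cong R t s
  | WCtrans s t w : word_cong R s t -> word_cong R t w -> word_cong R s w.

Section Presented.
Variables (A : Type) (R : seq A -> seq A -> Prop).

Let word := {classic (seq A)}.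

Definition word_congb : rel word := fun s t => `[< word_cong R s t >].

Lemma word_congb_refl : reflexive word_congb.
Proof. by move=> s; apply/asboolP; exact: WCrefl. Qed.

Lemma word_congb_sym : symmetric word_congb.
Proof. by move=> s t; apply/asboolP/asboolP; exact: WCsym. Qed.

Lemma word_congb_trans : transitive word_congb.
Proof.
by move=> t s w /asboolP st /asboolP tw; apply/asboolP; exact: WCtrans st tw.
Qed.

Canonical word_congb_equiv :=
  EquivRel word_congb word_congb_refl word_congb_sym word_congb_trans.

Definition presented : Type := {eq_quot word_congb_equiv}.
HB.instance Definition _ := Choice.on presented.
HB.instance Definition _ := Quotient.on presented.

Definition wclass (s : seq A) : presented := \pi_presented (s : word).

Definition wrepr (a : presented) : seq A := (repr a : word).

Lemma wreprK a : wclass (wrepr a) = a.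
Proof. exact: reprK. Qed.

Lemma wclassP s t : wclass s = wclass t <-> word_cong R s t.
Proof.
have e := @eqmodE _ word_congb_equiv (s : word) (t : word).
split => [st|st].
  have : word_congb s t by rewrite -[word_congb s t]e; apply/eqP.
  by move/asboolP.
by apply/eqP; rewrite [X in is_true X]e; apply/asboolP.
Qed.

Lemma word_cong_cat s s' t t' :
  word_cong R s s' -> word_cong R t t' -> word_cong R (s ++ t) (s' ++ t').
Proof.
have catl w u v : word_cong R u v -> word_cong R (w ++ u) (w ++ v).
  elim=> [p q a b ab|a|a b _ IH|a b c _ IH1 _ IH2].
  - by rewrite !(catA w); exact: WCrel.
  - exact: WCrefl.
  - exact: WCsym.
  - exact: WCtrans IH1 IH2.
have catr w u v : word_cong R u v -> word_cong R (u ++ w) (v ++ w).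
  elim=> [p q a b ab|a|a b _ IH|a b c _ IH1 _ IH2].
  - by rewrite -!catA; exact: WCrel.
  - exact: WCrefl.
  - exact: WCsym.
  - exact: WCtrans IH1 IH2.
by move=> ss tt; apply: WCtrans (catr _ _ _ ss) (catl _ _ _ tt).
Qed.

Definition presented_mul (a b : presented) : presented :=
  wclass (wrepr a ++ wrepr b).
Definition presented_one : presented := wclass [::].

Lemma wclass_cat s t : wclass (s ++ t) = presented_mul (wclass s) (wclass t).
Proof.
apply/wclassP/word_cong_cat; apply/wclassP; by rewrite wreprK.
Qed.

Lemma presented_mulA : associative presented_mul.
Proof.
move=> a b c; rewrite -[a]wreprK -[b]wreprK -[c]wreprK.
by rewrite -!wclass_cat catA.
Qed.

Lemma presented_mul1 : left_id presented_one presented_mul.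
Proof. by move=> a; rewrite -[a in LHS]wreprK -wclass_cat wreprK. Qed.

Lemma presented_1mul : right_id presented_one presented_mul.
Proof. by move=> a; rewrite -[a in LHS]wreprK -wclass_cat cats0 wreprK. Qed.

HB.instance Definition _ := isMonoid.Build presented
  presented_mulA presented_mul1 presented_1mul.

End Presented.

(* Set-theoretic maps [r : X * X -> X * X], written r (x, y) = (^x y, x^y). *)

Definition lact (X : Type) (r : X * X -> X * X) (x y : X) : X := (r (x, y)).1.
Definition ract (X : Type) (r : X * X -> X * X) (x y : X) : X := (r (x, y)).2.

Definition quadratic_set (X : Type) (r : X * X -> X * X) : Prop :=
  inhabited X /\ bijective r.

Definition r12 (X : Type) (r : X * X -> X * X) (t : X * X * X) : X * X * X :=
  let: (x, y, z) := t in (lact r x y, ract r x y, z).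

Definition r23 (X : Type) (r : X * X -> X * X) (t : X * X * X) : X * X * X :=
  let: (x, y, z) := t in (x, lact r y z, ract r y z).

Definition yang_baxter (X : Type) (r : X * X -> X * X) : Prop :=
  r12 r \o r23 r \o r12 r =1 r23 r \o r12 r \o r23 r.

Definition solution (X : Type) (r : X * X -> X * X) : Prop :=
  quadratic_set r /\ yang_baxter r.

Definition has_order (T : Type) (f : T -> T) (n : nat) : Prop :=
  [/\ (0 < n)%N, iter n f =1 id
    & forall m, (0 < m)%N -> iter m f =1 id -> (n <= m)%N].

(* Holds for every [k] when [f] has infinite order. *)
Definition lt_order (T : Type) (k : nat) (f : T -> T) : Prop :=
  forall n, has_order f n -> (k < n)%N.

Definition two_cancellative (X : Type) (r : X * X -> X * X) : Prop :=
  forall k, (0 < k)%N -> lt_order k r ->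
    (forall x y z, iter k r (x, y) = (x, z) -> z = y) /\
    (forall x y t, iter k r (x, y) = (t, y) -> x = t).

Definition lri (X : Type) (r : X * X -> X * X) : Prop :=
  forall z w, ract r (lact r z w) z = w /\ w = lact r z (ract r w z).

Inductive assoc_rel (X : Type) (r : X * X -> X * X) : seq X -> seq X -> Prop :=
  | AssocRel x y z t : r (x, y) = (z, t) -> assoc_rel r [:: x; y] [:: z; t].

Definition assoc_monoid (X : Type) (r : X * X -> X * X) : Type :=
  presented (assoc_rel r).
HB.instance Definition _ (X : Type) (r : X * X -> X * X) :=
  Monoid.on (assoc_monoid r).

Definition mgen (X : Type) (r : X * X -> X * X) (x : X) : assoc_monoid r :=
  wclass (assoc_rel r) [:: x].

(* The length of any word representing [a], by [mlenE]. *)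
Definition mlen (X : Type) (r : X * X -> X * X) (a : assoc_monoid r) : nat :=
  size (wrepr a).

Lemma mlenE (X : Type) (r : X * X -> X * X) (s : seq X) :
  mlen (wclass (assoc_rel r) s : assoc_monoid r) = size s.
Proof.
have word_cong_size u v : word_cong (assoc_rel r) u v -> size u = size v.
  elim=> [p q _ _ [x y z t _]|//|//|a b c _ -> _ -> //].
  by rewrite !size_cat.
by apply/word_cong_size/wclassP; rewrite wreprK.
Qed.

Definition cancellation_length3 (X : Type) (r : X * X -> X * X) : Prop :=
  forall a b c : assoc_monoid r,
    (mlen a + mlen b = 3)%N -> (mlen a + mlen c = 3)%N ->
    (a * b = a * c -> b = c) /\ (b * a = c * a -> b = c).

(* The group, presented as a monoid on the letters [(x, true)], for x, and
   [(x, false)], for its inverse. *)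
Inductive assoc_group_rel (X : Type) (r : X * X -> X * X) :
    seq (X * bool) -> seq (X * bool) -> Prop :=
  | AGRel x y z t : r (x, y) = (z, t) ->
      assoc_group_rel r [:: (x, true); (y, true)] [:: (z, true); (t, true)]
  | AGInv x b : assoc_group_rel r [:: (x, b); (x, ~~ b)] [::].

Definition assoc_group (X : Type) (r : X * X -> X * X) : Type :=
  presented (assoc_group_rel r).
HB.instance Definition _ (X : Type) (r : X * X -> X * X) :=
  Monoid.on (assoc_group r).

Definition ggen (X : Type) (r : X * X -> X * X) (x : X) : assoc_group r :=
  wclass (assoc_group_rel r) [:: (x, true)].

Section AssocGroup.
Variables (X : Type) (r : X * X -> X * X).

Let inv_word (s : seq (X * bool)) := rev [seq (p.1, ~~ p.2) | p <- s].

Definition assoc_group_inv (a : assoc_group r) : assoc_group r :=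
  wclass (assoc_group_rel r) (inv_word (wrepr a)).

Lemma inv_word_cong s : word_cong (assoc_group_rel r) (s ++ inv_word s) [::].
Proof.
elim: s => [|[x b] s IH]; first exact: WCrefl.
rewrite /inv_word /= rev_cons -/(inv_word s) -cats1.
apply: (@WCtrans _ _ _ ([:: (x, b)] ++ [::] ++ [:: (x, ~~ b)])).
  have -> : (x, b) :: s ++ inv_word s ++ [:: (x, ~~ b)]
          = [:: (x, b)] ++ (s ++ inv_word s) ++ [:: (x, ~~ b)] by rewrite -catA.
  by apply: word_cong_cat (WCrefl _ _) (word_cong_cat IH (WCrefl _ _)).
by apply: (@WCrel _ _ [::] [::] [:: (x, b); (x, ~~ b)] [::]); constructor.
Qed.

Lemma inv_wordK : involutive inv_word.
Proof.
move=> s; rewrite /inv_word map_rev revK -map_comp -[RHS]map_id.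
by apply: eq_map => -[x b] /=; rewrite negbK.
Qed.

Lemma assoc_group_mulV : right_inverse 1 assoc_group_inv *%g.
Proof.
move=> a; rewrite -[a in X in X * _]wreprK /assoc_group_inv.
by rewrite -[LHS]wclass_cat; apply/wclassP; exact: inv_word_cong.
Qed.

Lemma assoc_group_Vmul : left_inverse 1 assoc_group_inv *%g.
Proof.
move=> a; rewrite -[a in X in _ * X]wreprK /assoc_group_inv.
rewrite -[LHS]wclass_cat; apply/wclassP.
by rewrite -{2}[wrepr a]inv_wordK; exact: inv_word_cong.
Qed.

HB.instance Definition _ := hasInv.Build (assoc_group r) assoc_group_inv.
HB.instance Definition _ :=
  Monoid_isGroup.Build (assoc_group r) assoc_group_Vmul assoc_group_mulV.

End AssocGroup.

Definition left_action (M : monoidType) (T : Type) (a : M -> T -> T) : Prop :=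
  (forall t, a 1 t = t) /\ (forall g h t, a (g * h) t = a g (a h t)).

Definition right_action (M : monoidType) (T : Type) (a : T -> M -> T) : Prop :=
  (forall t, a t 1 = t) /\ (forall g h t, a t (g * h) = a (a t g) h).

(* The disjoint union of X and Y is the sum type [X + Y], with X embedded by
   [inl] and Y by [inr]. *)

Definition map_pair (A A' B B' : Type) (f : A -> A') (g : B -> B')
  (p : A * B) : A' * B' := (f p.1, g p.2).

Definition regular_extension (X Y : Type)
    (rX : X * X -> X * X) (rY : Y * Y -> Y * Y)
    (r : (X + Y) * (X + Y) -> (X + Y) * (X + Y)) : Prop :=
  [/\ bijective r,
      forall p : X * X, r (map_pair inl inl p) = map_pair inl inl (rX p),
      forall p : Y * Y, r (map_pair inr inr p) = map_pair inr inr (rY p)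
    & exists (s : Y * X -> X * Y) (s' : X * Y -> Y * X),
        [/\ cancel s s', cancel s' s,
            forall p : Y * X, r (map_pair inr inl p) = map_pair inl inr (s p)
          & forall p : X * Y, r (map_pair inl inr p) = map_pair inr inl (s' p)]].

Section StrongTwistedUnion.
Variables (X Y : Type) (rX : X * X -> X * X) (rY : Y * Y -> Y * Y).
Variable r : (X + Y) * (X + Y) -> (X + Y) * (X + Y).

Definition extends_left (M : monoidType) (gen : Y -> M) : Prop :=
  exists a : M -> X -> X, left_action a /\
    forall (alpha : Y) (x : X),
      inl (a (gen alpha) x) = lact r (inr alpha) (inl x).

Definition extends_right (M : monoidType) (gen : X -> M) : Prop :=
  exists a : Y -> M -> Y, right_action a /\
    forall (alpha : Y) (x : X),
      inr (a alpha (gen x)) = ract r (inr alpha) (inl x).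

Definition strong_twisted_union : Prop :=
  [/\ regular_extension rX rY r,
      extends_left (@ggen Y rY) /\ extends_left (@mgen Y rY),
      extends_right (@ggen X rX) /\ extends_right (@mgen X rX),
      forall (x y : X) (alpha : Y),
        lact r (ract r (inr alpha) (inl y)) (inl x)
        = lact r (inr alpha) (inl x)
    & forall (x : X) (alpha beta : Y),
        ract r (inr alpha) (lact r (inr beta) (inl x))
        = ract r (inr alpha) (inl x)].

Definition csla : Prop := forall (x y : X) (alpha : Y),
  lact r (lact r (inl y) (inr alpha)) (lact r (inl y) (inl x))
  = lact r (lact r (inr alpha) (inl y)) (lact r (inr alpha) (inl x)).

Definition csra : Prop := forall (x : X) (alpha beta : Y),
  ract r (ract r (inr alpha) (inr beta)) (ract r (inl x) (inr beta))
  = ract r (ract r (inr alpha) (inl x)) (ract r (inr beta) (inl x)).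

End StrongTwistedUnion.

(* Main.v *)
(* By lri, each map ^z(-) is a bijection with inverse (-)^z.  With condition
   (2) this turns csla into ^a(^y x) = ^(^a y)(^a x) and csra into
   (a^b)^x = (a^x)^(b^x): each factor acts on the other by automorphisms.
   These are the only components of the braid relation on Y * X * X and
   Y * Y * X which do not already follow from the actions in (1), from (2) and
   from lri.  The other mixed triples reduce to these two because r is
   involutive on X * Y and Y * X. *)
Require Import Defs.
From mathcomp Require Import all_boot.

Definition braid_at {Z : Type} (r : Z * Z -> Z * Z) (t : Z * Z * Z) : Prop :=
  r12 r (r23 r (r12 r t)) = r23 r (r12 r (r23 r t)).

(** With A = [r12 r], B = [r23 r] and u = A B A t, the relation at A t reads A B t = B u, because A
    A t = t. Applying B gives B A B t = u, which is the relation at t. *)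
Lemma braid_at_r12 {Z : Type} (r : Z * Z -> Z * Z) (t : Z * Z * Z) :
  r12 r (r12 r t) = t ->
  (let u := r12 r (r23 r (r12 r t)) in r23 r (r23 r u) = u) ->
  braid_at r (r12 r t) -> braid_at r t.
Proof. by rewrite /braid_at => -> /= uK e; rewrite -uK -e. Qed.

Lemma braid_at_r23 {Z : Type} (r : Z * Z -> Z * Z) (t : Z * Z * Z) :
  r23 r (r23 r t) = t ->
  (let u := r23 r (r12 r (r23 r t)) in r12 r (r12 r u) = u) ->
  braid_at r (r23 r t) -> braid_at r t.
Proof. by rewrite /braid_at => -> /= uK e; rewrite -uK e. Qed.

Lemma mgen_mul_braid {X : Type} (r : X * X -> X * X) (x y : X) :
  (mgen r x * mgen r y = mgen r (lact r x y) * mgen r (ract r x y))%g.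
Proof.
rewrite -[LHS]wclass_cat -[RHS]wclass_cat; apply/wclassP.
apply: (@WCrel _ _ [::] [::] [:: x; y] [:: lact r x y; ract r x y]).
by constructor; rewrite /lact /ract -surjective_pairing.
Qed.

(** Turns the question which entries of a triple lie in [X] into a boolean that can be computed by
    rewriting after any application of [r12 r] or [r23 r]. *)
Definition is_left {A B : Type} (z : A + B) : bool := if z is inl _ then true else false.

(** * Braid relation on regular extensions *)

Section RegularExtension.
Context {X Y : Type} {rX : X * X -> X * X} {rY : Y * Y -> Y * Y}.
Context {r : (X + Y) * (X + Y) -> (X + Y) * (X + Y)}.

(** Both sides are actions on [x] of one element of the monoid of [rY], written in two ways by a
    defining relation. *)
Lemma extends_left_braid : extends_left r (@mgen Y rY) ->
  forall (a b : Y) (x : X),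
    lact r (inr a) (lact r (inr b) (inl x))
    = lact r (inr (lact rY a b)) (lact r (inr (ract rY a b)) (inl x)).
Proof.
case=> act [[_ actM] actE] a b x.
by rewrite -!actE -!actM mgen_mul_braid.
Qed.

Lemma extends_right_braid : extends_right r (@mgen X rX) ->
  forall (a : Y) (x y : X),
    ract r (ract r (inr a) (inl x)) (inl y)
    = ract r (ract r (inr a) (inl (lact rX x y))) (inl (ract rX x y)).
Proof.
case=> act [[_ actM] actE] a x y.
by rewrite -!actE -!actM mgen_mul_braid.
Qed.

Hypothesis ext : regular_extension rX rY r.

Lemma is_left_lact z w : is_left (lact r z w) = is_left w.
Proof.
case: ext => _ hX hY [s [s' [_ _ hs hs']]].
case: z w => [x|a] [y|b]; rewrite /lact.
- by rewrite (hX (x, y)).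
- by rewrite (hs' (x, b)).
- by rewrite (hs (a, y)).
- by rewrite (hY (a, b)).
Qed.

Lemma is_left_ract z w : is_left (ract r z w) = is_left z.
Proof.
case: ext => _ hX hY [s [s' [_ _ hs hs']]].
case: z w => [x|a] [y|b]; rewrite /ract.
- by rewrite (hX (x, y)).
- by rewrite (hs' (x, b)).
- by rewrite (hs (a, y)).
- by rewrite (hY (a, b)).
Qed.

Lemma mixed_involutive z w : is_left z != is_left w -> r (r (z, w)) = (z, w).
Proof.
case: ext => _ _ _ [s [s' [sK s'K hs hs']]].
case: z w => [x|a] [y|b] // _.
- by rewrite (hs' (x, b)) hs s'K.
- by rewrite (hs (a, y)) hs' sK.
Qed.

Lemma r12K z w v : is_left z != is_left w -> r12 r (r12 r (z, w, v)) = (z, w, v).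
Proof.
move/mixed_involutive; rewrite /r12 /lact /ract.
by case: (r (z, w)) => a b /= ->.
Qed.

Lemma r23K z w v : is_left w != is_left v -> r23 r (r23 r (z, w, v)) = (z, w, v).
Proof.
move/mixed_involutive; rewrite /r23 /lact /ract.
by case: (r (w, v)) => a b /= ->.
Qed.

Lemma lactXX x y : lact r (inl x) (inl y) = inl (lact rX x y).
Proof. by case: ext => _ hX _ _; rewrite /lact (hX (x, y)). Qed.

Lemma ractXX x y : ract r (inl x) (inl y) = inl (ract rX x y).
Proof. by case: ext => _ hX _ _; rewrite /ract (hX (x, y)). Qed.

Lemma lactYY a b : lact r (inr a) (inr b) = inr (lact rY a b).
Proof. by case: ext => _ _ hY _; rewrite /lact (hY (a, b)). Qed.

Lemma ractYY a b : ract r (inr a) (inr b) = inr (ract rY a b).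
Proof. by case: ext => _ _ hY _; rewrite /ract (hY (a, b)). Qed.

(** The relation passes from YXX to XYX to XXY, and from YYX to YXY to XYY. Each step transposes
    adjacent entries of different types, where [r] is involutive. Both sides of the relation reverse
    the types of a triple, so involutivity is also available at the image, as [braid_at_r12] and
    [braid_at_r23] require. *)
Lemma yang_baxter_regular_extension :
  yang_baxter rX -> yang_baxter rY ->
  (forall a x y, braid_at r (inr a, inl x, inl y)) ->
  (forall a b x, braid_at r (inr a, inr b, inl x)) ->
  yang_baxter r.
Proof.
move=> ybX ybY yxx yyx.
have sides := (is_left_lact, is_left_ract).
(* Restated by types, since the entries of [r12 r t] and [r23 r t] are not syntactically [inl] or
   [inr]. *)
have {}yxx z w v : is_left z = false -> is_left w -> is_left v -> braid_at r (z, w, v).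
  by case: z w v => [?|a] [x|?] [y|?].
have {}yyx z w v : is_left z = false -> is_left w = false -> is_left v -> braid_at r (z, w, v).
  by case: z w v => [?|a] [?|b] [x|?].
have xyx z w v : is_left z -> is_left w = false -> is_left v -> braid_at r (z, w, v).
  move=> hz hw hv.
  by apply: braid_at_r12;
    [rewrite r12K | apply: r23K | apply: yxx]; rewrite ?sides ?hz ?hw ?hv.
have yxy z w v : is_left z = false -> is_left w -> is_left v = false -> braid_at r (z, w, v).
  move=> hz hw hv.
  by apply: braid_at_r23;
    [rewrite r23K | apply: r12K | apply: yyx]; rewrite ?sides ?hz ?hw ?hv.
case=> [[[x|a] [y|b]] [z|c]].
- move: (ybX (x, y, z)); rewrite /= !(lactXX, ractXX) => -[e1 e2 e3].
  by rewrite e1 e2 e3.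
- by apply: braid_at_r23;
    [rewrite r23K | apply: r12K | apply: xyx]; rewrite ?sides.
- exact: xyx.
- by apply: braid_at_r12;
    [rewrite r12K | apply: r23K | apply: yxy]; rewrite ?sides.
- exact: yxx.
- exact: yxy.
- exact: yyx.
- move: (ybY (a, b, c)); rewrite /= !(lactYY, ractYY) => -[e1 e2 e3].
  by rewrite e1 e2 e3.
Qed.

End RegularExtension.

(** * Strong twisted unions with lri *)

Section StrongTwistedUnion.
Context {X Y : Type} {rX : X * X -> X * X} {rY : Y * Y -> Y * Y}.
Context {r : (X + Y) * (X + Y) -> (X + Y) * (X + Y)}.
Hypothesis stu : strong_twisted_union rX rY r.
Hypothesis lriZ : lri r.

Let ext : regular_extension rX rY r. Proof. by case: stu. Qed.

Lemma lactK z : cancel (lact r z) (ract r ^~ z).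
Proof. by move=> w; case: (lriZ z w). Qed.

Lemma ractK z : cancel (ract r ^~ z) (lact r z).
Proof. by move=> w; case: (lriZ z w). Qed.

(** By lri, a = (^y a)^y, so this is condition (2) for the element ^y a of [Y]. *)
Lemma lact_lact y a x :
  lact r (lact r (inl y) (inr a)) (inl x) = lact r (inr a) (inl x).
Proof.
case: stu => _ _ _ h2 _.
case eb: (lact r (inl y) (inr a)) (is_left_lact ext (inl y) (inr a)) => [//|b] _.
by rewrite -(h2 x y b) -eb lactK.
Qed.

Lemma ract_ract a b x :
  ract r (inr a) (ract r (inl x) (inr b)) = ract r (inr a) (inl x).
Proof.
case: stu => _ _ _ _ h2.
case ey: (ract r (inl x) (inr b)) (is_left_ract ext (inl x) (inr b)) => [y|//] _.
by rewrite -(h2 y a b) -ey ractK.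
Qed.

Lemma cslaE : csla r <-> forall a x y,
  lact r (inr a) (lact r (inl x) (inl y))
  = lact r (lact r (inr a) (inl x)) (lact r (inr a) (inl y)).
Proof.
by split=> h u v w; rewrite -h (lactXX ext) lact_lact.
Qed.

Lemma csraE : csra r <-> forall a b x,
  ract r (ract r (inr a) (inr b)) (inl x)
  = ract r (ract r (inr a) (inl x)) (ract r (inr b) (inl x)).
Proof.
by split=> h u v w; rewrite -h (ractYY ext) ract_ract.
Qed.

(** After (2), the first component is the stated identity and the third comes from the action of the
    monoid of [rX]. The middle one is ^a(x^y) = (^a x)^(^a y). *)
Lemma braid_at_yxx a :
  (forall x y, braid_at r (inr a, inl x, inl y)) <->
  (forall x y, lact r (inr a) (lact r (inl x) (inl y))
               = lact r (lact r (inr a) (inl x)) (lact r (inr a) (inl y))).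
Proof.
case: stu => _ _ [_ actR] h2 _.
rewrite /braid_at /=; split=> e x y; move: (e x y).
  by rewrite (lactXX ext) (ractXX ext) !h2 => -[<-].
rewrite (lactXX ext) (ractXX ext) !h2 -(extends_right_braid actR) => ->.
congr (_, _, _).
(* Since x = ^y(x^y), the identity gives ^a x = ^(^a y)(^a(x^y)), and lri cancels the outer
   action. *)
by rewrite -[inl x](ractK (inl y)) (ractXX ext) e lactK.
Qed.

(** Mirror image: now the third component is the identity, the first comes from the action, and the
    middle one is (^a b)^x = ^(a^x)(b^x). *)
Lemma braid_at_yyx x :
  (forall a b, braid_at r (inr a, inr b, inl x)) <->
  (forall a b, ract r (ract r (inr a) (inr b)) (inl x)
               = ract r (ract r (inr a) (inl x)) (ract r (inr b) (inl x))).
Proof.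
case: stu => _ [_ actL] _ _ h2.
rewrite /braid_at /=; split=> e a b; move: (e a b).
  by rewrite (lactYY ext) (ractYY ext) !h2 => -[_ _ <-].
rewrite (lactYY ext) (ractYY ext) !h2 -(extends_left_braid actL) => ->.
congr (_, _, _).
(* Write b = (^a b)^a, distribute (-)^x, and cancel by lri. *)
by rewrite -[inr b in RHS](lactK (inr a)) (lactYY ext) e ractK.
Qed.

End StrongTwistedUnion.

Theorem proposition5p4 (X Y : Type)
    (rX : X * X -> X * X) (rY : Y * Y -> Y * Y)
    (r : (X + Y) * (X + Y) -> (X + Y) * (X + Y))
    (solX : solution rX) (cancX : two_cancellative rX)
    (solY : solution rY) (cancY : two_cancellative rY)
    (stu : strong_twisted_union rX rY r)
    (lriZ : lri r)
    (canc3 : cancellation_length3 r) :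
  yang_baxter r <-> csla r /\ csra r.
Proof.
have ext : regular_extension rX rY r by case: stu.
rewrite (cslaE stu lriZ) (csraE stu lriZ); split=> [yb|[hl hr]].
  split=> [a|a b x]; first by apply/(braid_at_yxx stu lriZ) => *; exact: (yb (_, _, _)).
  by move: a b; apply/(braid_at_yyx stu lriZ) => *; exact: (yb (_, _, _)).
apply: (yang_baxter_regular_extension ext (proj2 solX) (proj2 solY)) => [a|a b x].
- by apply/(braid_at_yxx stu lriZ); exact: hl.
- by move: a b; apply/(braid_at_yyx stu lriZ) => *; exact: hr.
Qed.
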